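(* For every $k\in\mathbb{N}$, $k\geq 1$, there exist graphs (with a source-destination pair $(s,t)$) for which any resilient source-matched routing that can tolerate $2k$ dynamic failures (i.e. any $2k$-resilient source-matched routing scheme against dynamic failures) needs rewriting of at least $k$ bits in packet headers.
   Context: Graphs are finite undirected (multi)graphs. Dynamic failures: a set $F\subseteq E$ of unstable links; each link of $F$ may alternate arbitrarily between up and down over time (when down it fails in both directions), including while a packet travels; links outside $F$ are always up. Source-matched header-rewriting routing scheme for $(s,t)$ with $b$ bits: each packet header contains $b$ reserved rewritable bits; every node $v\neq t$ has a static deterministic function, which may depend on both the source $s$ and the destination $t$, whose input is the in-port of the packet (or $\bot$ if the packet originates at $v$), the set of links incident to $v$ that are currently up, and the current values of the $b$ bits, and whose output is an outgoing link together with new values of the $b$ bits. It is $r$-resilient against dynamic failures if for every set $F$ of dynamic failures with $|F|\le r$ such that $s$ and $t$ are connected in $G\setminus F$ (the graph with all of $F$ removed), a packet originating at $s$ is delivered to $t$, however the states of the links of $F$ evolve. Non-trap assumption (standing): it is assumed that the dynamic failures in $F$ cannot lead the routing functions to direct a packet across different connected components of $G\setminus F$. *)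

(* Defs.v *)
From mathcomp Require Import all_boot.

Set Implicit Arguments.
Unset Strict Implicit.
Unset Printing Implicit Defensive.

(* Finite undirected multigraph without self-loops: parallel links are distinct
   elements of [link] with the same pair of ends. *)
Record multigraph := Multigraph {
  vert : finType;
  link : finType;
  ends : link -> {set vert};
  card_ends : forall e : link, #|ends e| = 2 }.

Section Routing.
Variable G : multigraph.

Definition incident (v : vert G) : {set link G} := [set e | v \in ends e].

Definition adj_without (F : {set link G}) : rel (vert G) :=
  fun u v => [exists e : link G, (e \notin F) && (ends e == [set u; v])].

Definition connected_without (F : {set link G}) : rel (vert G) :=
  connect (adj_without F).

(* Routing functions for one fixed source-destination pair, so that dependence
   on both endpoints is built in.  The arguments are the node, the in-port
   ([None] for a packet originating at the node), the set of incident links that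
   are up, and the header bits.  The result [None] means that the packet is
   dropped: it gives a node with no usable link a value.  The function of the
   destination is never called. *)
Definition routing_scheme (b : nat) : Type :=
  vert G -> option (link G) -> {set link G} -> b.-tuple bool ->
  option (link G * b.-tuple bool).

(* Current node, in-port and header of a packet. *)
Definition packet (b : nat) : Type :=
  (vert G * option (link G) * b.-tuple bool)%type.

Section Run.
Variables (b : nat) (f : routing_scheme b) (s t : vert G).

(* One forwarding decision while exactly the links of [D] are down; [None] means
   that the packet is lost (dropped, or sent on a link that is down or not
   incident to the current node).  The packet stops at [t]. *)
Definition forward (D : {set link G}) (p : packet b) : option (packet b) :=
  let: (v, i, h) := p in
  if v == t then Some p else
  let up := incident v :\: D in
  if f v i up h is Some (e, h') then
    if e \in up then
      omap (fun w => (w, Some e, h')) [pick w | ends e == [set v; w]]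
    else None
  else None.

(* [down n] is the set of links that are down at the n-th forwarding decision.
   Fixing the initial header loses no generality, as [s] rewrites it when it
   first handles the packet. *)
Fixpoint run (down : nat -> {set link G}) (n : nat) : option (packet b) :=
  if n is m.+1 then obind (forward (down m)) (run down m)
  else Some (s, None, nseq_tuple b false).

Definition delivered (down : nat -> {set link G}) : Prop :=
  exists n i h, run down n = Some (t, i, h).

(* No hop takes the packet from one connected component of G \ F to another. *)
Definition non_trap (F : {set link G}) (down : nat -> {set link G}) : Prop :=
  forall n v i h v' i' h',
    run down n = Some (v, i, h) -> run down n.+1 = Some (v', i', h') ->
    connected_without F v v'.

(* Without [non_trap], a packet could be stranded in a component of G \ F that
   does not contain [t], and no routing could prevent it. *)
Definition resilient (r : nat) : Prop :=
  forall F : {set link G}, #|F| <= r -> connected_without F s t ->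
  forall down : nat -> {set link G}, (forall n, down n \subset F) ->
  non_trap F down -> delivered down.

End Run.
End Routing.

(* Main.v *)
(** In both graphs the adversary plays a memoryless strategy: the links down
    depend only on the current node and in-port, and the packet stays forever in
    a set of states that avoids the destination.

    For [k >= 2] take an inlet, [k] levels of two rungs with complete bipartite
    links between consecutive levels, and an outlet (the destination).  A choice
    [y] of one rung per level is a corridor from inlet to outlet; the other rungs
    form a second path, to which the source is attached.  Failing the [2k] links
    between the two, except the link from source to inlet, the adversary shows
    every link up inside the corridor and every failing link down outside it.  A
    packet that leaves the corridor can only re-enter it through the source, so
    that all it remembers is its header.  Hence some header must make the packet,
    seeing no failure at all, follow the corridor to its end.  That walk
    determines [y], so there are at least as many headers as corridors.  The source
    subdivides one link between the first two levels, which excludes only one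
    corridor in four: [3 * 2 ^ (k - 2) > 2 ^ (k - 1)] of them remain.

    For [k = 1] the graph is a source joined to two hubs, each with a two-hop path
    through a stub to the destination, and a two-hop path through a middle node
    between the hubs.  When the link after a stub is down, the packet bounces back
    to the hub, which cannot tell this from an arrival through the stub; playing
    such bounces against each other traps every routing without header bits. *)

From HB Require Import structures.
From Stdlib Require Import Classical.
Require Import Defs.
From mathcomp Require Import all_boot zify.

Set Implicit Arguments.
Unset Strict Implicit.
Unset Printing Implicit Defensive.

(** * Adversary strategies *)

Section Trap.
Variables (G : multigraph) (b : nat) (f : routing_scheme G b) (s t : vert G).

Section Strategy.
Variable D : packet G b -> {set link G}.

Definition play (n : nat) : option (packet G b) :=
  iter n (obind (fun p => forward f t (D p) p)) (Some (s, None, nseq_tuple b false)).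

Definition downs (n : nat) : {set link G} := if play n is Some p then D p else set0.

(** Routing is deterministic, so a strategy that reacts to the packet unrolls into a fixed schedule
    of failures. *)
Lemma run_downs n : run f s t downs n = play n.
Proof.
elim: n => // n IHn.
by rewrite /= IHn /downs; case E: (play n).
Qed.

End Strategy.

Lemma connected_without_sym F u v :
  @connected_without G F u v = connected_without F v u.
Proof.
apply: sym_connect_sym => {}u {}v.
by apply: eq_existsb => e; rewrite setUC.
Qed.

(** As the graph without [F] stays connected, [non_trap] holds for free; [P] is an invariant that
    keeps the packet off [t]. *)
Lemma trap_not_resilient r (F : {set link G}) (u0 : vert G)
    (D : packet G b -> {set link G}) (P : packet G b -> Prop) :
  #|F| <= r -> (forall u, connected_without F u0 u) ->
  (forall p, D p \subset F) ->
  P (s, None, nseq_tuple b false) ->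
  (forall p, P p -> p.1.1 != t) ->
  (forall p p', P p -> forward f t (D p) p = Some p' -> P p') ->
  ~ resilient f s t r.
Proof.
move=> leFr conF DF P0 Pt PS res.
have con u v : connected_without F u v.
  by apply: connect_trans (conF v); rewrite -/(connected_without F u u0) connected_without_sym.
have Pplay n p : play D n = Some p -> P p.
  elim: n p => [p [<-] //|n IHn p]; rewrite /play /= -/(play D n).
  by case E: (play D n) => [q|] //=; apply: PS; apply: IHn.
have sub n : downs D n \subset F.
  by rewrite /downs; case: (play D n) => [p|]; rewrite ?sub0set.
have [|n [i [h]]] := res F leFr (con _ _) (downs D) sub; first by move=> *; exact: con.
by rewrite run_downs => /Pplay/Pt /=; rewrite eqxx.
Qed.

End Trap.

(** * Graphs given by the two ends of each link *)

Section Wired.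
Variables (V L : finType) (src dst : L -> V).
Hypothesis src_dst : forall e, src e != dst e.

Lemma card_wired_ends e : #|[set src e; dst e]| = 2.
Proof. by rewrite cards2 src_dst. Qed.

Definition wired := Multigraph card_wired_ends.

Definition joins (e : L) (u v : V) : bool :=
  (src e == u) && (dst e == v) || (src e == v) && (dst e == u).

Lemma joins_ends e : joins e (src e) (dst e).
Proof. by rewrite /joins !eqxx. Qed.

Lemma wired_connect (F : {set L}) (e : L) u v : e \notin F -> joins e u v ->
  @connected_without wired F u v.
Proof.
move=> eF juv; apply: connect1; apply/existsP; exists e; rewrite eF /=.
by case/orP: juv => /andP[/eqP-> /eqP->] //; rewrite setUC.
Qed.

Lemma wired_forward b (f : routing_scheme wired b) (t : V) (D : {set L})
    (p p' : packet wired b) :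
  forward f t D p = Some p' ->
  p.1.1 = t /\ p' = p \/
  exists e, [/\ f p.1.1 p.1.2 (incident (G := wired) p.1.1 :\: D) p.2 = Some (e, p'.2),
                p'.1.2 = Some e, e \notin D & joins e p.1.1 p'.1.1].
Proof.
case: p => [[v i] h]; rewrite /forward; case: eqP => [-> [<-]|_]; first by left.
case E: (f v i _ h) => [[e h']|] //; case: ifP => // eU.
case: pickP => //= w /eqP ends_e [<-]; right; exists e; split=> //=.
  by move: eU; rewrite inE => /andP[].
have /setP endsE : [set src e; dst e] = [set v; w] := ends_e.
(* Testing the equality of the two pairs at all four ends decides which end is which. *)
move: (endsE (src e)) (endsE (dst e)) (endsE v) (endsE w) (src_dst e).
rewrite !inE !eqxx ?orbT /= ?orTb /joins ![_ == src e]eq_sym ![_ == dst e]eq_sym.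
by do 4!case: eqP => //= ?; subst; rewrite ?eqxx.
Qed.

End Wired.

(** * Two failures and no header bits *)

Inductive dnode := Src | Dst | Mid | Hub of bool | Stub of bool.

Definition dnode_enc v : option (option (option (bool + bool))) :=
  match v with
  | Src => None | Dst => Some None | Mid => Some (Some None)
  | Hub c => Some (Some (Some (inl c))) | Stub c => Some (Some (Some (inr c)))
  end.

Definition dnode_dec x :=
  match x with
  | None => Src | Some None => Dst | Some (Some None) => Mid
  | Some (Some (Some (inl c))) => Hub c | Some (Some (Some (inr c))) => Stub c
  end.

Lemma dnode_encK : cancel dnode_enc dnode_dec. Proof. by case. Qed.
HB.instance Definition _ := Finite.copy dnode (can_type dnode_encK).

Inductive dlink := SH of bool | HS of bool | SD of bool | HM of bool.

Definition dlink_enc e : (bool + bool) + (bool + bool) :=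
  match e with
  | SH c => inl (inl c) | HS c => inl (inr c) | SD c => inr (inl c) | HM c => inr (inr c)
  end.

Definition dlink_dec x :=
  match x with
  | inl (inl c) => SH c | inl (inr c) => HS c | inr (inl c) => SD c | inr (inr c) => HM c
  end.

Lemma dlink_encK : cancel dlink_enc dlink_dec. Proof. by case. Qed.
HB.instance Definition _ := Finite.copy dlink (can_type dlink_encK).

Definition dsrc e := match e with SH c | HS c | HM c => Hub c | SD c => Stub c end.
Definition ddst e := match e with SH _ => Src | HS c => Stub c | SD _ => Dst | HM _ => Mid end.

Lemma dsrc_ddst e : dsrc e != ddst e. Proof. by case: e. Qed.

Notation diamond := (wired dsrc_ddst).

Section DiamondRouting.
Variable f : routing_scheme diamond 0.
Hypothesis res : resilient f Src Dst 2.

Definition out (v : dnode) (i : option dlink) (D : {set dlink}) : option dlink :=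
  omap fst (f v i (incident (G := diamond) v :\: D) [tuple]).

(** Seven nodes and eight links: what survives the two failures is a spanning tree. *)
Lemma diamond_connected c e (u : dnode) : (e == SH (~~ c)) || (e == HM (~~ c)) ->
  @connected_without diamond [set SD c; e] (Hub c) u.
Proof.
move=> eE; set con := @connected_without diamond _ (Hub c).
have hop e' v w : joins dsrc ddst e' v w -> (e' != SD c) && (e' != e) -> con v -> con w.
  move=> jvw eF /connect_trans; apply; apply: wired_connect jvw.
  by rewrite !inE negb_or.
have con_hub : con (Hub c) by exact: connect0.
have con_src : con Src.
  by apply: (hop (SH c)) con_hub; [case: (c) | case/orP: eE => /eqP->; case: (c)].
have con_mid : con Mid.
  by apply: (hop (HM c)) con_hub; [case: (c) | case/orP: eE => /eqP->; case: (c)].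
have con_hub' : con (Hub (~~ c)).
  case/orP: (eE) => /eqP eqe.
    by apply: (hop (HM (~~ c))) con_mid; rewrite ?eqe; case: (c).
  by apply: (hop (SH (~~ c))) con_src; rewrite ?eqe; case: (c).
have con_stub' : con (Stub (~~ c)).
  by apply: (hop (HS (~~ c))) con_hub'; [case: (c) | case/orP: eE => /eqP->; case: (c)].
have cases d : d = c \/ d = ~~ c by case: d; case: (c); auto.
case: u => [|||d|d] //.
- by apply: (hop (SD (~~ c))) con_stub'; [case: (c) | case/orP: eE => /eqP->; case: (c)].
- by case: (cases d) => ->.
case: (cases d) => -> //.
by apply: (hop (HS c)) con_hub; [case: (c) | case/orP: eE => /eqP->; case: (c)].
Qed.

Lemma diamond_trap (F : {set dlink}) (u0 : dnode) (D : dnode -> option dlink -> {set dlink})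
    (P : dnode -> option dlink -> bool) :
  #|F| <= 2 -> (forall u, @connected_without diamond F u0 u) ->
  (forall v i, D v i \subset F) ->
  P Src None -> (forall i, ~~ P Dst i) ->
  ~ (forall v i e w, P v i -> out v i (D v i) = Some e -> e \notin D v i ->
       joins dsrc ddst e v w -> P w (Some e)).
Proof.
move=> leF con DF P0 PD PS.
pose Q (p : packet diamond 0) := P p.1.1 p.1.2 : Prop.
apply: (@trap_not_resilient diamond 0 f Src Dst 2 F u0 (fun p => D p.1.1 p.1.2) Q) => //.
  move=> [[v i] h]; rewrite /Q /=; apply: contraTneq => ->; exact: PD.
move=> p p' Qp /wired_forward[[pD _]|[e [fE iE eD j]]].
  by move: Qp; rewrite /Q pD (negPf (PD _)).
rewrite /Q iE; apply: (PS p.1.1 p.1.2) eD j => //.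
have -> : out p.1.1 p.1.2 =
    fun A => omap fst (f p.1.1 p.1.2 (incident (G := diamond) p.1.1 :\: A) p.2).
  by rewrite /out (_ : [tuple] = p.2) //; apply: val_inj; rewrite [in RHS]tuple0.
by rewrite fE.
Qed.

Lemma diamond_escape c e (D : dnode -> option dlink -> {set dlink})
    (P : dnode -> option dlink -> bool) :
  (e == SH (~~ c)) || (e == HM (~~ c)) ->
  (forall v i, D v i \subset [set SD c; e]) ->
  P Src None -> (forall i, ~~ P Dst i) ->
  ~ (forall v i e' w, P v i -> out v i (D v i) = Some e' -> e' \notin D v i ->
       joins dsrc ddst e' v w -> P w (Some e')).
Proof.
move=> eE; apply: diamond_trap; first by rewrite cards2; case: (_ != _).
by move=> u; apply: diamond_connected.
Qed.

(* [congruence] is syntactic, while elaboration leaves [reverse_coercion] in the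
   type of some occurrences of [set0]. *)
Ltac by_cases_on v i e w :=
  case: v => [|||[]|[]]; case: i => [[[]|[]|[]|[]]|] //=;
  case: e => [[]|[]|[]|[]]; case: w => [|||[]|[]] //=;
  rewrite ?inE //=; move=> *; unfold reverse_coercion in *; congruence.

(* [Stub c] is a dead end and [Src] sends every packet back to [Hub c], so that
   [Dst] can only be reached from [Src] through [Hub c], [Mid], [Hub (~~ c)]. *)
Definition stub_and_src (c : bool) (v : dnode) (i : option dlink) : {set dlink} :=
  match v with
  | Stub c' => if c' == c then [set SD c] else set0
  | Src => [set SH (~~ c)]
  | _ => set0
  end.

Lemma stub_and_src_sub c v i : stub_and_src c v i \subset [set SD c; SH (~~ c)].
Proof.
case: v => [|||d|d] /=; rewrite ?sub0set ?subsetUr //.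
by case: ifP; rewrite ?sub0set ?subsetUl.
Qed.

(** [Hub (~~ c)] is entered only from [Mid]; unless it then tries its stub, the packet never takes
    the only way left to [Dst]. *)
Lemma out_far_hub c : out (Hub (~~ c)) (Some (HM (~~ c))) set0 = Some (HS (~~ c)).
Proof.
apply/eqP; apply: contraT => /eqP ne; exfalso.
apply: (@diamond_escape c (SH (~~ c)) (stub_and_src c) (fun v i =>
  match v, i with
  | Src, (None | Some (SH _)) | Mid, Some (HM _) => true
  | Hub c', Some (HM c'') => c' == c''
  | Hub c', Some (SH c'' | HS c'') | Stub c', Some (HS c'') => (c' == c) && (c'' == c)
  | _, _ => false
  end)) => //; rewrite ?eqxx //; first exact: stub_and_src_sub.
move=> v i e w; case: c ne => /= ne; by_cases_on v i e w.
Qed.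

(** Otherwise the packet never reaches [Hub (~~ c)]. *)
Lemma out_mid c : out Mid (Some (HM c)) set0 = Some (HM (~~ c)).
Proof.
apply/eqP; apply: contraT => /eqP ne; exfalso.
apply: (@diamond_escape c (SH (~~ c)) (stub_and_src c) (fun v i =>
  match v, i with
  | Src, None => true
  | Src, Some (SH c') | Mid, Some (HM c') => c' == c
  | Hub c', Some (SH c'' | HS c'' | HM c'') => (c' == c) && (c'' == c)
  | Stub c', Some (HS c'') => (c' == c) && (c'' == c)
  | _, _ => false
  end)) => //; rewrite ?eqxx //; first exact: stub_and_src_sub.
move=> v i e w; case: c ne => /= ne; by_cases_on v i e w.
Qed.

(** Otherwise the packet bounces between [Src] and [Hub c] forever. *)
Lemma out_hub_neq c : out (Hub c) (Some (SH c)) set0 <> Some (SH c).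
Proof.
move=> eq_out.
apply: (@diamond_escape c (SH (~~ c)) (stub_and_src c) (fun v i =>
  match v, i with
  | Src, None => true
  | Src, Some (SH c') => c' == c
  | Hub c', Some (SH c'') => (c' == c) && (c'' == c)
  | _, _ => false
  end)) => //; rewrite ?eqxx //; first exact: stub_and_src_sub.
move=> v i e w; case: c eq_out => /= eq_out; by_cases_on v i e w.
Qed.

(** If neither arrival leads to [Mid], the packet is confined to [Src], [Hub c] and [Stub c]. *)
Lemma out_hub_mid c : out (Hub c) (Some (SH c)) set0 <> Some (HM c) ->
  out (Hub c) (Some (HS c)) set0 = Some (HM c).
Proof.
move=> ne1; apply/eqP; apply: contraT => /eqP ne2; exfalso.
apply: (@diamond_escape c (SH (~~ c)) (stub_and_src c) (fun v i =>
  match v, i with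
  | Src, None => true
  | Src, Some (SH c') => c' == c
  | Hub c', Some (SH c'' | HS c'') => (c' == c) && (c'' == c)
  | Stub c', Some (HS c'') => (c' == c) && (c'' == c)
  | _, _ => false
  end)) => //; rewrite ?eqxx //; first exact: stub_and_src_sub.
move=> v i e w; case: c ne1 ne2 => /= ne1 ne2; by_cases_on v i e w.
Qed.

Definition stub_and_mid (c : bool) (v : dnode) (i : option dlink) : {set dlink} :=
  match v with
  | Stub c' => if c' == c then [set SD c] else set0
  | Mid => [set HM (~~ c)]
  | _ => set0
  end.

(* [Mid] turns back packets from [Hub c] but lets those from [Hub (~~ c)] through. *)
Definition stub_and_mid_back (c : bool) (v : dnode) (i : option dlink) : {set dlink} :=
  match v with
  | Stub c' => if c' == c then [set SD c] else set0
  | Mid => if i == Some (HM (~~ c)) then set0 else [set HM (~~ c)]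
  | _ => set0
  end.

Lemma stub_and_mid_sub c v i : stub_and_mid c v i \subset [set SD c; HM (~~ c)].
Proof.
case: v => [|||d|d] /=; rewrite ?sub0set ?subsetUr //.
by case: ifP; rewrite ?sub0set ?subsetUl.
Qed.

Lemma stub_and_mid_back_sub c v i : stub_and_mid_back c v i \subset [set SD c; HM (~~ c)].
Proof.
case: v => [|||d|d] /=; rewrite ?sub0set //; case: ifP;
  by rewrite ?sub0set ?subsetUl ?subsetUr.
Qed.

Lemma diamond_not_resilient : False.
Proof.
(* Without a valid first hop the packet is lost at once; this hop fixes the side [c]. *)
have [c src_c] : exists c, out Src None set0 = Some (SH c).
{ case E: (out Src None set0) => [[c|c|c|c]|]; first by exists c.
  all: exfalso; apply: (@diamond_escape true (SH false) (fun _ _ => set0) (fun v i =>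
    match v, i with Src, None => true | _, _ => false end)) => //.
  all: try by move=> *; exact: sub0set.
  all: move=> v i e w; by_cases_on v i e w. }
have hub_c := out_far_hub (~~ c); rewrite negbK in hub_c.
have hub_nc := out_far_hub c; have mid_c := out_mid c; have mid_nc := out_mid (~~ c).
have src_ne := @out_hub_neq c; have := @out_hub_mid c.
case: (out (Hub c) (Some (SH c)) set0 =P Some (HM c)) =>
  [hub_src _ | hub_src /(_ hub_src) hub_stub].
  (* [Hub c] sends packets from [Src] straight to [Mid], so [Stub c] is never tried; the other stub
     is blocked, and [Mid] allows no return to [Hub c]. *)
  apply: (@diamond_escape (~~ c) (HM c) (stub_and_mid_back (~~ c)) (fun v i =>
    match v, i with
    | Src, None | Mid, Some (HM _) => true
    | Src, Some (SH c') => c' == ~~ c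
    | Hub c', Some (SH c'') => c' == c''
    | Hub c', Some (HS c'' | HM c'') => (c' == ~~ c) && (c'' == ~~ c)
    | Stub c', Some (HS c'') => (c' == ~~ c) && (c'' == ~~ c)
    | _, _ => false
    end)) => //; first by rewrite negbK eqxx orbT.
    by have := stub_and_mid_back_sub (~~ c); rewrite negbK.
  move=> v i e w; case: c src_c hub_c hub_nc mid_c mid_nc src_ne hub_src => /=.
    by move=> ? ? ? ? ? ? ?; by_cases_on v i e w.
  by move=> ? ? ? ? ? ? ?; by_cases_on v i e w.
(* [Hub c] answers a bounce at [Stub c] with [Mid] and a bounce at [Mid] with [Stub c]: an endless
   cycle. *)
apply: (@diamond_escape c (HM (~~ c)) (stub_and_mid c) (fun v i =>
    match v, i with
    | Src, None => true
    | Mid, Some (HM c') => c' == c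
    | Hub c', Some (SH c'' | HS c'' | HM c'') => (c' == c) && (c'' == c)
    | Stub c', Some (HS c'') => (c' == c) && (c'' == c)
    | _, _ => false
    end)) => //; first by rewrite eqxx orbT.
  exact: stub_and_mid_sub.
move=> v i e w {hub_nc mid_c mid_nc}.
case: c src_c hub_c src_ne hub_src hub_stub => /= ? ? ? ? ?;
  by_cases_on v i e w.
Qed.

End DiamondRouting.

(** * At least four failures *)

Inductive lnode (n : nat) := Start | Inlet | Outlet | Rung of 'I_n.+2 & bool.
Arguments Start {n}. Arguments Inlet {n}. Arguments Outlet {n}.

Section LadderFin.
Variable n : nat.

Definition lnode_enc (v : lnode n) : option (option (option ('I_n.+2 * bool))) :=
  match v with
  | Start => None | Inlet => Some None | Outlet => Some (Some None)
  | Rung j c => Some (Some (Some (j, c)))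
  end.

Definition lnode_dec x : lnode n :=
  match x with
  | None => Start | Some None => Inlet | Some (Some None) => Outlet
  | Some (Some (Some (j, c))) => Rung j c
  end.

Lemma lnode_encK : cancel lnode_enc lnode_dec. Proof. by case. Qed.
HB.instance Definition _ := Finite.copy (lnode n) (can_type lnode_encK).
End LadderFin.

Inductive llink (n : nat) :=
  StartInlet | StartRung | InletRung of bool | RungOutlet of bool
| Cross of 'I_n.+1 & bool & bool.
Arguments StartInlet {n}. Arguments StartRung {n}.
Arguments InletRung {n}. Arguments RungOutlet {n}.

Section Ladder.
Variable n : nat.

Definition llink_enc (e : llink n) : (bool + bool + bool) + 'I_n.+1 * bool * bool :=
  match e with
  | StartInlet => inl (inl (inl true)) | StartRung => inl (inl (inl false))
  | InletRung c => inl (inl (inr c)) | RungOutlet c => inl (inr c)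
  | Cross i c d => inr (i, c, d)
  end.

Definition llink_dec x : llink n :=
  match x with
  | inl (inl (inl true)) => StartInlet | inl (inl (inl false)) => StartRung
  | inl (inl (inr c)) => InletRung c | inl (inr c) => RungOutlet c
  | inr (i, c, d) => Cross i c d
  end.

Lemma llink_encK : cancel llink_enc llink_dec. Proof. by case. Qed.
HB.instance Definition _ := Finite.copy (llink n) (can_type llink_encK).

Definition rung (i : nat) (c : bool) : lnode n := Rung (inord i) c.

(* [Start] subdivides the link between [rung 0 false] and [rung 1 false], whose
   second half is [StartRung]. *)
Definition detoured (i : nat) (c d : bool) : bool := [&& i == 0, ~~ c & ~~ d].

Definition lsrc (e : llink n) : lnode n :=
  match e with
  | StartInlet | StartRung => Start
  | InletRung _ => Inlet
  | RungOutlet c => rung n.+1 c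
  | Cross i c _ => rung i c
  end.

Definition ldst (e : llink n) : lnode n :=
  match e with
  | StartInlet => Inlet
  | StartRung => rung 1 false
  | InletRung c => rung 0 c
  | RungOutlet _ => Outlet
  | Cross i c d => if detoured i c d then Start else rung i.+1 d
  end.

Lemma lsrc_ldst e : lsrc e != ldst e.
Proof.
case: e => [||c|c|i c d] //=; case: ifP => // _.
have lt_i := ltn_ord i; apply/eqP => -[] /(congr1 val).
by rewrite /= !inordK; lia.
Qed.

Definition ladder : multigraph := wired lsrc_ldst.

(** * Corridors and the failing links around them *)

Section World.
Variable y : 'I_n.+2 -> bool.
(** Otherwise [Start] would interrupt the corridor between its first two rungs. *)
Hypothesis y01 : y (inord 0) || y (inord 1).

Definition corridor (v : lnode n) : bool :=
  match v with
  | Start => false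
  | Inlet | Outlet => true
  | Rung j c => c == y j
  end.

Definition cut : {set llink n} :=
  [set e | (e != StartInlet) && (corridor (lsrc e) != corridor (ldst e))].

(** One link is cut at each end; between consecutive levels, one out of the corridor and one into
    it. *)
Lemma card_cut : #|cut| <= 2 * n.+2.
Proof.
pose yn i := y (inord i).
(* If [yn 1] fails, [y01] gives [yn 0], so the link into the corridor is the subdivided one; only
   its half [StartRung] is cut. *)
pose back (i : 'I_n.+1) : llink n :=
  if (i == 0 :> nat) && ~~ yn 1 then StartRung else Cross i (~~ yn i) (yn i.+1).
pose A := [set InletRung (~~ yn 0); RungOutlet (~~ yn n.+1)].
pose B := [set Cross i (yn i) (~~ yn i.+1) | i : 'I_n.+1].
pose C := [set back i | i : 'I_n.+1].
have sub : cut \subset A :|: B :|: C.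
  apply/subsetP => e; rewrite !inE => /andP[].
  case: e => [||c|c|i c d] //=.
  - move=> _ y1; apply/orP; right; apply/imsetP; exists ord0 => //.
    by rewrite /back eqxx; case: ifP => //; move: y1; rewrite -/(yn 1); case: (yn 1).
  - by move=> _; rewrite -/(yn 0); case: c; case: (yn 0) => // _; rewrite ?eqxx.
  - by move=> _; rewrite -/(yn n.+1); case: c; case: (yn n.+1) => // _; rewrite ?eqxx ?orbT.
  move=> _; rewrite -/(yn i) => ne.
  suff [[-> ->]|eb] : (c = yn i /\ d = ~~ yn i.+1) \/ Cross i c d = back i.
  + by rewrite imset_f ?orbT.
  + by rewrite eb imset_f ?orbT.
  move: ne; rewrite /back /detoured; case: (eqVneq (i : nat) 0) => [i0|_] /=; last first.
    rewrite -/(yn i.+1); case: c; case: d; case: (yn i); case: (yn i.+1) => //= _;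
      by [left | right].
  move: y01; rewrite -/(yn 0) -/(yn 1) i0.
  case: c; case: d => /=; rewrite -?/(yn 1); case: (yn 0); case: (yn 1) => //= _;
    by [left | right].
apply: leq_trans (subset_leq_card sub) _.
apply: leq_trans (leq_card_setU _ _) _.
have leB : #|B| <= n.+1 by apply: leq_trans (leq_imset_card _ _) _; rewrite card_ord.
have leC : #|C| <= n.+1 by apply: leq_trans (leq_imset_card _ _) _; rewrite card_ord.
have leA : #|A| <= 2 by rewrite cards2; case: (_ != _).
apply: leq_trans (leq_add (leq_trans (leq_card_setU _ _) (leq_add leA leB)) leC) _; lia.
Qed.

(** Each side is connected by its own links, and [StartInlet] joins the two. *)
Lemma cut_connected u : @connected_without ladder cut Start u.
Proof.
pose con := @connected_without ladder cut Start.
have hop e : e \notin cut -> con (lsrc e) = con (ldst e).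
  move=> eF; apply/idP/idP => /connect_trans; apply;
    apply: (@wired_connect _ _ _ _ lsrc_ldst _ e) => //.
    exact: joins_ends.
  by rewrite /joins !eqxx orbT.
have side e : corridor (lsrc e) = corridor (ldst e) -> con (lsrc e) = con (ldst e).
  by move=> eqc; apply: hop; rewrite inE eqc eqxx andbF.
have con_inlet : con Inlet.
  by rewrite -(hop StartInlet) ?inE //; exact: connect0.
pose yn i := y (inord i).
have y01' : yn 0 || yn 1 by [].
have corr i c : corridor (rung i c) = (c == yn i) by [].
have cross i c d : i < n.+1 -> (c == yn i) = (d == yn i.+1) -> ~~ detoured i c d ->
    con (rung i c) = con (rung i.+1 d).
  move=> lt_i eqc ndet; have := side (Cross (Ordinal lt_i) c d).
  rewrite [ldst _]/= (negPf ndet) [lsrc _]/= !corr; exact.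
have start0 : yn 0 -> con (rung 0 false).
  move=> y0; have -> : con (rung 0 false) = con Start; last exact: connect0.
  by apply: (side (Cross ord0 false false)); rewrite [lsrc _]/= [ldst _]/= corr y0.
have start1 : yn 1 -> con (rung 1 false).
  move=> y1; have <- : con Start = con (rung 1 false); last exact: connect0.
  by apply: (side StartRung); rewrite [ldst _]/= corr y1.
have con_on i : i < n.+2 -> con (rung i (yn i)).
  elim: i => [_|i IHi lt_i].
    by rewrite -(side (InletRung (yn 0))) // [ldst _]/= corr eqxx.
  rewrite -(cross i (yn i)) ?eqxx //; first by apply: IHi; lia.
  by move: y01'; case: (i) => // ; rewrite /detoured /= -negb_or => ->.
have con_off01 : con (rung 0 (~~ yn 0)) /\ con (rung 1 (~~ yn 1)).
  have := cross 0 false true isT; have := cross 0 true false isT.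
  move: y01' start0 start1.
  by case: (yn 0); case: (yn 1) => // _ r0 r1 c0 c1; split;
    rewrite ?r0 ?r1 // -?c1 ?c0 // ?r0 ?r1.
have con_off i : i < n.+2 -> con (rung i (~~ yn i)).
  elim: i => [_|[_ _|i IHi lt_i]]; [by case: con_off01 .. |].
  rewrite -(cross i.+1 (~~ yn i.+1)) //; first by apply: IHi; lia.
  by case: (yn _); case: (yn _).
have con_rung j c : con (Rung j c).
  have := con_on j (ltn_ord j); have := con_off j (ltn_ord j).
  by rewrite /rung /yn inord_val; case: c; case: (y j).
case: u => //; first exact: connect0.
change (con (ldst (RungOutlet (yn n.+1)))).
by rewrite -side ?[lsrc _]/= ?con_rung // corr eqxx.
Qed.

End World.

Definition level (v : lnode n) : nat :=
  match v with Start | Inlet => 0 | Rung j _ => j.+1 | Outlet => n.+3 end.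

Lemma level_rung i c : i < n.+2 -> level (rung i c) = i.+1.
Proof. by move=> lt_i; rewrite /= inordK. Qed.

(** Off the corridor this fails: [StartRung] leads from level 0 to level 2. *)
Lemma corridor_step y e v w :
  joins lsrc ldst e v w -> corridor y v -> corridor y w -> level w <= (level v).+1.
Proof.
have H : corridor y (lsrc e) -> corridor y (ldst e) -> level (ldst e) = (level (lsrc e)).+1.
  case: e => [||c|c|i c d] // _.
  - by move=> _; rewrite [ldst _]/= level_rung.
  - by move=> _; rewrite [lsrc _]/= level_rung.
  rewrite [ldst _]/=; case: ifP => // _ _; have := ltn_ord i.
  by move=> lt_i; rewrite [lsrc _]/= !level_rung //; lia.
by case/orP => /andP[/eqP <- /eqP <-] cv cw; rewrite H // ltnW.
Qed.

(** * Failure-free walks from the inlet *)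

Section Walk.
Variables (b : nat) (f : routing_scheme ladder b).

Definition walk (h : b.-tuple bool) (m : nat) : option (packet ladder b) :=
  iter m (obind (forward f Outlet set0)) (Some (Inlet, Some StartInlet, h)).

(** The default [Start] lies off every corridor, so a lost packet counts as having left. *)
Definition walk_node h m : lnode n := if walk h m is Some p then p.1.1 else Start.

Definition stays (y : 'I_n.+2 -> bool) h m : Prop :=
  forall i, i <= m -> corridor y (walk_node h i).

Definition crosses y h : Prop := exists2 m, stays y h m & walk_node h m = Outlet.

(** A discrete intermediate value theorem: levels start at 0 and rise by at most one per step. *)
Lemma stays_level y h m j : stays y h m -> j <= level (walk_node h m) ->
  exists2 i, i <= m & level (walk_node h i) = j.
Proof.
elim: m => [|m IHm] st.
  by rewrite /walk_node /= leqn0 => /eqP ->; exists 0.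
have stm : stays y h m by move=> i lt_i; apply: st; lia.
case: (leqP j (level (walk_node h m))) => [/(IHm stm)[i le_i <-] _|lt_m le_j].
  by exists i => //; lia.
exists m.+1 => //; apply/eqP; rewrite eqn_leq le_j andbT.
apply: leq_trans lt_m.
have := st m (leqnSn m); have := st m.+1 (leqnn _).
rewrite /walk_node /walk /= -/(walk h m); case: (walk h m) => [p|] //=.
case E: (forward f Outlet set0 p) => [p'|] //=.
have [[_ ->] //|[e [_ _ _ j_e]] cp' cp] := wired_forward E.
exact: corridor_step j_e cp cp'.
Qed.

(** Up to the earlier of the two arrivals, the one walk of [h] stays in both corridors and meets
    every level, at a rung common to both. *)
Lemma crosses_inj y y' h : crosses y h -> crosses y' h -> y =1 y'.
Proof.
move=> [m st out] [m' st' out'].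
wlog le_m : y y' m m' st st' out out' / m <= m'.
  move=> W; case/orP: (leq_total m m') => le_m; first exact: (W y y' m m').
  by move=> j; apply/esym; apply: (W y' y m' m).
move=> j; have lt_j := ltn_ord j; have [|i le_i] := @stays_level y h m j.+1 st.
  by rewrite out /=; lia.
have := st' i (leq_trans le_i le_m); have := st i le_i.
case: (walk_node h i) => [|||j' c] //=; last first.
  by move=> /eqP -> /eqP eq_y [/val_inj <-].
by move=> _ _ [eq_n]; move: lt_j; rewrite -eq_n ltnn.
Qed.

Lemma resilient_crosses y : y (inord 0) || y (inord 1) ->
  resilient f Start Outlet (2 * n.+2) -> exists h, crosses y h.
Proof.
move=> y01 res; apply: NNPP => no_cross.
pose D (p : packet ladder b) : {set llink n} := if corridor y p.1.1 then set0 else cut y.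
pose P (p : packet ladder b) := ~~ corridor y p.1.1 \/
  exists h m, walk h m = Some p /\ stays y h m.
have PS p p' : P p -> forward f Outlet (D p) p = Some p' -> P p'.
  have [cp' Pp fp|] := boolP (corridor y p'.1.1); last by left.
  right; have [[p_out eq_p]|[e [_ e_in eD j_e]]] := wired_forward fp.
    by subst p'; case: Pp => //; rewrite cp'.
  case: (boolP (corridor y p.1.1)) => cp; rewrite /D ?cp ?(negPf cp) in fp eD.
    case: Pp => [|[h [m [w_m st]]]]; first by rewrite cp.
    have w_S : walk h m.+1 = Some p' by rewrite /walk /= -/(walk h m) w_m.
    exists h, m.+1; split=> // i; rewrite leq_eqVlt => /predU1P[->|]; last exact: st.
    by rewrite /walk_node w_S.
  (* Every other link into the corridor is down, so re-entry looks like the start of a walk,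
     whatever the header. *)
  have eE : e = StartInlet.
    apply/eqP; apply: contraNT eD => ne; rewrite inE ne /=.
    by case/orP: j_e => /andP[/eqP -> /eqP ->]; rewrite cp' (negPf cp).
  have p'E : p' = (Inlet, Some StartInlet, p'.2).
    case: p' e_in j_e cp' {fp} => [[v i] h] /= -> ; rewrite eE /joins /=.
    by case/orP => /andP[] => [_ /eqP <-|/eqP <-].
  exists p'.2, 0; split; first by rewrite {2}p'E.
  by move=> i; rewrite leqn0 => /eqP ->.
apply: (@trap_not_resilient ladder b f Start Outlet _ (cut y) Start D P) res => //.
- exact: card_cut.
- exact: cut_connected.
- by move=> p; rewrite /D; case: ifP => _; rewrite ?sub0set.
- by left.
move=> p [|[h [m [w_m st]]]]; first by apply: contraNneq => ->.
apply/eqP => out; case: no_cross; exists h; exists m => //.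
by rewrite /walk_node w_m.
Qed.

End Walk.

(* [Some z] ranges over the corridors through [rung 0 true]; a single further one,
   [None], suffices to exceed [2 ^ n.+1]. *)
Definition world (w : option {ffun 'I_n.+1 -> bool}) (j : 'I_n.+2) : bool :=
  match w, unlift ord0 j with
  | Some z, Some i => z i
  | None, None => false
  | _, _ => true
  end.

Lemma world01 w : world w (inord 0) || world w (inord 1).
Proof.
have -> : inord 0 = ord0 :> 'I_n.+2 by apply: val_inj; rewrite /= inordK.
have -> : inord 1 = lift ord0 ord0 :> 'I_n.+2 by apply: val_inj; rewrite /= inordK.
by rewrite /world unlift_none liftK; case: w.
Qed.

Lemma world_inj w w' : world w =1 world w' -> w = w'.
Proof.
move=> eq_w; have := eq_w ord0; rewrite /world unlift_none.
case: w w' eq_w => [z|] [z'|] // eq_z _; congr Some; apply/ffunP => i.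
by have := eq_z (lift ord0 i); rewrite /world liftK.
Qed.

Lemma ladder_bits b (f : routing_scheme ladder b) :
  resilient f Start Outlet (2 * n.+2) -> n.+2 <= b.
Proof.
move=> res.
have [g gP] : exists g : {ffun option {ffun 'I_n.+1 -> bool} -> b.-tuple bool},
    forall w, crosses f (world w) (g w).
  have [w|g gP] := @fin_all_exists _ _ (fun w h => crosses f (world w) h).
    exact: resilient_crosses (world01 w) res.
  by exists (finfun g) => w; rewrite ffunE.
have inj_g : injective g.
  move=> w w' eq_g; apply: world_inj.
  by apply: crosses_inj (gP w) _; rewrite eq_g; exact: gP.
(* Pigeonhole: [1 + 2 ^ n.+1] corridors have distinct headers among [2 ^ b]. *)
have := leq_card g inj_g.
rewrite card_option card_ffun card_tuple card_bool card_ord => lt_2.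
by rewrite -(@ltn_exp2l 2).
Qed.

End Ladder.

Theorem theorem15 (k : nat) (hk : 1 <= k) :
  exists (G : multigraph) (s t : vert G),
    forall (b : nat) (f : routing_scheme G b),
      resilient f s t (2 * k) -> k <= b.
Proof.
case: k hk => [//|[|n]] _.
  exists diamond, Src, Dst => -[|b] // f res.
  by case: (diamond_not_resilient res).
by exists (ladder n), Start, Outlet => b f; exact: ladder_bits.
Qed.
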